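(* Let $\varphi:\mathbb{R}_+\to\mathbb{R}_+$ be a differentiable and strictly convex admissible function with $\varphi'(0)=0$. Let $f:X\to\mathbb{R}\cup\{+\infty\}$ be a proper lower semicontinuous function on a Banach space $X$ and let $\bar x\in{\rm dom}(f)$. Then $f$ has $\varphi$-SLWP at $\bar x$ if and only if $f$ has $(\varphi')^{-1}$-TSLM at $\bar x$.
   Context: $\mathbb{R}_+=[0,+\infty)$; $B_X(x,r)$ and $B_X[x,r]$ are the open and closed balls; ${\rm dom}(f)=\{x: f(x)<+\infty\}$; $X^*$ is the dual of $X$, and $f_{u^*}(x):=f(x)-\langle u^*,x\rangle$. Admissible function: a nondecreasing $\varphi:\mathbb{R}_+\to\mathbb{R}_+$ with $\varphi(0)=0$ such that $\varphi(t)\to0$ implies $t\to0$. The derivative at $0$ is the right derivative. Under the hypotheses, $\varphi'$ is continuous and strictly increasing, and $(\varphi')^{-1}$ is its inverse function, defined on the range $\varphi'(\mathbb{R}_+)$. $\varphi$-SLWP (stable local well-posedness) of $f$ at $\bar x\in{\rm dom}(f)$: there exist $\delta,r,\tau,\kappa\in(0,+\infty)$ such that for every $u^*\in B_{X^*}(0,\delta)$ there is $x_{u^*}\in B_X[\bar x,r]$, with $x_0=\bar x$, satisfying $\varphi(\kappa\|x-x_{u^*}\|)\le\tau(f_{u^*}(x)-f_{u^*}(x_{u^*}))$ for all $x\in B_X[\bar x,r]$. $\psi$-TSLM ($\psi$-tilt-stable local minimum) of $f$ at $\bar x$: there exist $\delta,r,\kappa,\tau\in(0,+\infty)$ and a map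 $M:B_{X^*}(0,\delta)\to B_X[\bar x,r]$ with $M(0)=\bar x$ such that $M(u^* )\in\mathop{\arg\min}_{x\in B_X(\bar x,r)}f_{u^*}(x)$ for all $u^*\in B_{X^*}(0,\delta)$ and $\kappa\|M(u_1^* )-M(u_2^* )\|\le\psi(\tau\|u_1^*-u_2^*\|)$ for all $u_1^*,u_2^*\in B_{X^*}(0,\delta)$. For $\psi=(\varphi')^{-1}$ it is understood that $\delta,\tau$ are such that all the numbers $\tau\|u_1^*-u_2^*\|$ lie in $\varphi'(\mathbb{R}_+)$. *)

(* Defs.v *)
From HB Require Import structures.
From mathcomp Require Import all_boot all_order all_algebra.
From mathcomp Require Import all_classical all_reals all_analysis.

Set Implicit Arguments.
Unset Strict Implicit.
Unset Printing Implicit Defensive.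

Import Order.TTheory GRing.Theory Num.Theory.
Import numFieldNormedType.Exports.

Local Open Scope classical_set_scope.
Local Open Scope ring_scope.

Section RealFunctions.
Context {R : realType}.
Implicit Types phi : R -> R.

(* Functions on the half-line are total functions [R -> R]; only their values
   on the arguments [0 <= t] are ever used. *)
Definition half_line : set R := `[0, +oo[.

Definition admissible phi :=
  [/\ set_fun half_line half_line phi,
      {in half_line &, {homo phi : s t / s <= t}},
      phi 0 = 0 &
      forall t : R^nat, (forall n, half_line (t n)) ->
        phi (t n) @[n --> \oo] --> (0 : R) -> t n @[n --> \oo] --> (0 : R)].

Definition strictly_convex_on (A : set R) phi :=
  forall x y l, A x -> A y -> x != y -> 0 < l -> l < 1 ->
    phi (l * x + (1 - l) * y) < l * phi x + (1 - l) * phi y.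

Definition half_line_differentiable phi :=
  cvg (h^-1 * (phi h - phi 0) @[h --> 0^'+]) /\
  (forall t, 0 < t -> derivable phi t 1).

Definition half_line_derivative phi (t : R) : R :=
  if t == 0 then lim (h^-1 * (phi h - phi 0) @[h --> 0^'+])
  else derive1 phi t.

Definition derivative_range phi : set R :=
  half_line_derivative phi @` half_line.

(* The value of the partial inverse is irrelevant outside of
   [derivative_range phi]. *)
Definition derivative_inverse phi : R -> R :=
  'pinv_(fun=> 0) half_line (half_line_derivative phi).

End RealFunctions.

Section TiltStability.
Context {R : realType} {X : completeNormedModType R}.
Implicit Types (f : X -> \bar R) (u : X -> R) (x xbar : X).

Definition eff_dom f : set X := [set x | (f x < +oo)%E].

(* Excluding the value -oo makes [f] a function to R \cup {+oo}. *)
Definition proper_fun f := (forall x, (-oo < f x)%E) /\ eff_dom f !=set0.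

(* The dual space is a set of functions [X -> R]; its zero and its subtraction
   are the pointwise ones. *)
Definition topological_dual : set (X -> R) :=
  [set u : X -> R | scalar u /\ continuous u].

Definition dual_norm u : R := sup [set `|u x| | x in [set x : X | `|x| <= 1]].

Definition dual_ball (delta : R) : set (X -> R) :=
  [set u | topological_dual u /\ dual_norm u < delta].

Definition tilt f u : X -> \bar R := fun x => (f x - (u x)%:E)%E.

Definition argmin_on (A : set X) (g : X -> \bar R) : set X :=
  [set x | A x /\ forall y, A y -> (g x <= g y)%E].

(* The point x_{u^*} is [c u].  Since [+oo - +oo = -oo] in [\bar R], the
   inequality at [x = xbar] forces [c u] to be in [eff_dom f] when [xbar] is in
   [eff_dom f], so that no undefined difference is involved. *)
Definition SLWP (phi : R -> R) f xbar :=
  exists delta r tau kappa : R,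
    [/\ 0 < delta, 0 < r, 0 < tau & 0 < kappa] /\
    exists c : (X -> R) -> X,
      c 0 = xbar /\
      forall u, dual_ball delta u ->
        closed_ball xbar r (c u) /\
        forall x, closed_ball xbar r x ->
          ((phi (kappa * `|x - c u|))%:E
             <= tau%:E * (tilt f u x - tilt f u (c u)))%E.

(* [D] is the domain on which [psi] is defined.  [M] is a total function, of
   which only the restriction to [dual_ball delta] matters. *)
Definition TSLM (D : set R) (psi : R -> R) f xbar :=
  exists delta r kappa tau : R,
    [/\ 0 < delta, 0 < r, 0 < kappa & 0 < tau] /\
    exists M : (X -> R) -> X,
      [/\ set_fun (dual_ball delta) (closed_ball xbar r) M,
          M 0 = xbar,
          forall u, dual_ball delta u ->
            argmin_on (ball xbar r) (tilt f u) (M u) &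
          forall u1 u2, dual_ball delta u1 -> dual_ball delta u2 ->
            D (tau * dual_norm (u1 - u2)) /\
            kappa * `|M u1 - M u2| <= psi (tau * dual_norm (u1 - u2))].

End TiltStability.

(* Main.v *)
(* If [x_i] minimizes [f - u_i] with growth [phi], adding the two
   growth inequalities bounds [2 phi(kappa |x_1 - x_2|)] by a multiple of
   [|u_1 - u_2| |x_1 - x_2|], and convexity gives [t phi'(t / 2) <= 2 phi t].
   Conversely, let [y = x - M u] and let [w] norm [y], with the norm of [w] tuned
   so that TSLM gives [|M (u + w) - M u| <= |y| / 2].  Optimality of [M u] for [u]
   and of [M (u + w)] for [u + w] bounds the increase of [f - u] from [M u] to [x]
   from below by [w (x - M (u + w)) >= |w| |y| / 2], which dominates [phi] because
   [phi t <= t phi' t].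

   The norming functional comes from Hahn-Banach, in the following form: by Zorn
   there is a minimal sublinear functional below any given one, and it is linear
   because [x |-> inf_(t >= 0) p (x + t z) - t p z] is sublinear and below [p]. *)
Require Import Defs.
From HB Require Import structures.
From mathcomp Require Import all_boot all_order all_algebra.
From mathcomp Require Import all_classical all_reals all_analysis.
From mathcomp Require Import ring lra.
Set Implicit Arguments.
Unset Strict Implicit.
Import Order.TTheory GRing.Theory Num.Theory.
Import numFieldNormedType.Exports.
Local Open Scope classical_set_scope.
Local Open Scope ring_scope.

Lemma half_lineE {R : realType} (t : R) : half_line t = (0 <= t).
Proof. by rewrite /half_line /= in_itv /= andbT. Qed.

(** * Tangent inequalities and the derivative of a strictly convex function *)

Section ConvexDerivative.
Context {R : realType} (phi : R -> R).
Hypothesis phi_adm : admissible phi.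
Hypothesis phi_diff : half_line_differentiable phi.
Hypothesis phi_conv : strictly_convex_on half_line phi.
Hypothesis phi_d0 : half_line_derivative phi 0 = 0.

Implicit Types a b e s t y : R.
Local Notation dphi := (half_line_derivative phi).

Lemma admissible0 : phi 0 = 0. Proof. by case: phi_adm. Qed.

Lemma admissible_ge0 t : 0 <= t -> 0 <= phi t.
Proof.
by case: phi_adm => H _ _ _ t0; rewrite -half_lineE; apply: H; rewrite half_lineE.
Qed.

(** By convexity the difference quotient along [a * (t - s)], scaled by [t - s], is at most the
    chord [phi t - phi s]; it tends to the left-hand side as [a] tends to 0. *)
Lemma derivative_chord s t : 0 < s -> 0 <= t ->
  dphi s * (t - s) <= phi t - phi s.
Proof.
move=> s0 t0; case: (eqVneq t s) => [->|ts]; first by rewrite !subrr mulr0.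
rewrite leNgt; apply/negP => lt_chord.
have /cvg_ex[/= l cl] : cvg (h^-1 *: (phi (h + s) - phi s) @[h --> 0^']).
  have := phi_diff.2 s s0; rewrite /derivable.
  by under eq_fun do rewrite /= [_%:A]mulr1.
have dE : dphi s = l by rewrite /half_line_derivative gt_eqF // /derive1; exact: cvg_lim cl.
have cl' : h^-1 *: (phi (h + s) - phi s) * (t - s) @[h --> 0^'] --> dphi s * (t - s).
  by rewrite dE; apply: cvgMr_tmp.
have /= [e /= e0 he] := cvgr_gt _ cl' _ lt_chord.
have d0 : 0 < `|t - s| by rewrite normr_gt0 subr_eq0.
have ed : 0 < e + `|t - s| by apply: addr_gt0.
(* This weight lies in (0, 1) and makes [a * (t - s)] shorter than [e]. *)
pose a := e / (e + `|t - s|).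
have a0 : 0 < a by apply: divr_gt0.
have a1 : a < 1 by rewrite ltr_pdivrMr // mul1r ltrDl.
have h0 : a * (t - s) != 0 by apply: mulf_neq0; [rewrite gt_eqF|rewrite subr_eq0].
have := he (a * (t - s)); rewrite /= sub0r normrN normrM (gtr0_norm a0).
have -> : a * `|t - s| < e by rewrite mulrAC ltr_pdivrMr // ltr_pM2l // ltrDr.
move=> /(_ isT h0).
have := @phi_conv t s a; rewrite !half_lineE t0 (ltW s0) ts => /(_ isT isT isT a0 a1).
have -> : a * t + (1 - a) * s = a * (t - s) + s by ring.
move=> hc.
have -> : (a * (t - s))^-1 *: (phi (a * (t - s) + s) - phi s) * (t - s) =
   a^-1 * (phi (a * (t - s) + s) - phi s).
  by rewrite /GRing.scale /=; field; rewrite subr_eq0 ts gt_eqF.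
rewrite mulrC ltr_pdivlMr //; apply/negP; rewrite -leNgt.
by lra.
Qed.

Lemma admissible_gt0 t : 0 < t -> 0 < phi t.
Proof.
move=> t0; have := @phi_conv t 0 (1 / 2).
rewrite !half_lineE lexx (ltW t0) gt_eqF // admissible0.
move=> /(_ isT isT isT) H; have {}H : phi (1 / 2 * t + (1 - 1 / 2) * 0) <
  1 / 2 * phi t + (1 - 1 / 2) * 0 by apply: H; lra.
have : 0 <= phi (1 / 2 * t + (1 - 1 / 2) * 0) by apply: admissible_ge0; lra.
by lra.
Qed.

(** For [s > 0], the weak inequality at the midpoint of [s] and [t] becomes strict at [t] by strict
    convexity. At [s = 0] the tangent is the zero function, and positivity of [phi] suffices. *)
Lemma tangent_lt s t : 0 <= s -> 0 <= t -> t != s ->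
  phi s + dphi s * (t - s) < phi t.
Proof.
move=> s0 t0 ts; have [sN0|sN0] := eqVneq s 0.
  rewrite sN0 in ts *; rewrite phi_d0 mul0r addr0 admissible0 admissible_gt0 //.
  by rewrite lt_neqAle t0 eq_sym ts.
have {}s0 : 0 < s by rewrite lt_neqAle eq_sym sN0.
have := @phi_conv t s (1 / 2).
rewrite !half_lineE t0 (ltW s0) ts => /(_ isT isT isT) H.
have {}H : phi (1 / 2 * t + (1 - 1 / 2) * s) <
  1 / 2 * phi t + (1 - 1 / 2) * phi s by apply: H; lra.
have : dphi s * (1 / 2 * t + (1 - 1 / 2) * s - s) <=
  phi (1 / 2 * t + (1 - 1 / 2) * s) - phi s.
  by apply: derivative_chord => //; lra.
have -> : dphi s * (1 / 2 * t + (1 - 1 / 2) * s - s) = dphi s * (t - s) / 2.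
  by field.
lra.
Qed.

Lemma tangent_le s t : 0 <= s -> 0 <= t -> phi s + dphi s * (t - s) <= phi t.
Proof.
move=> s0 t0; have [->|ts] := eqVneq t s; first by rewrite subrr mulr0 addr0.
exact/ltW/tangent_lt.
Qed.

(** The strict tangent inequalities at [s] and at [t] are added. *)
Lemma dphi_lt s t : 0 <= s -> s < t -> dphi s < dphi t.
Proof.
move=> s0 st; have t0 := le_lt_trans s0 st.
have := tangent_lt s0 (ltW t0) (negbT (gt_eqF st)).
have := tangent_lt (ltW t0) s0 (negbT (lt_eqF st)) => h1 h2.
have : dphi s * (t - s) < dphi t * (t - s) by lra.
by rewrite ltr_pM2r // subr_gt0.
Qed.

Lemma dphi_le s t : 0 <= s -> s <= t -> dphi s <= dphi t.
Proof.
by move=> s0; rewrite le_eqVlt => /predU1P[->//|/(dphi_lt s0)/ltW].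
Qed.

Lemma dphi_gt0 t : 0 < t -> 0 < dphi t.
Proof. by move=> t0; rewrite -phi_d0; exact: dphi_lt. Qed.

(** Only the difference quotient at 0 is known to be small. The tangent at [e / 4], evaluated at
    [e / 2], turns [phi (e / 2) < y * (e / 4)] into a bound on the derivative. *)
Lemma dphi_small y : 0 < y -> exists2 e, 0 < e & dphi e < y.
Proof.
move=> y0; case: phi_diff => /cvg_ex[l cl] _.
have l0 : l = 0.
  rewrite -phi_d0 /half_line_derivative eqxx; apply/esym; exact: cvg_lim cl.
rewrite l0 in cl.
have [e /= e0 he] := cvgr_lt _ cl _ (divr_gt0 y0 (ltr0Sn _ 1)).
have e20 : 0 < e / 2 by rewrite divr_gt0.
have := he (e / 2); rewrite /= sub0r normrN gtr0_norm // ltr_pdivrMr //.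
rewrite admissible0 subr0 ltr_pMr // ltr1n => /(_ isT e20).
rewrite mulrC ltr_pdivrMr // => he2.
exists (e / 4); first by rewrite divr_gt0.
have := @tangent_le (e / 4) (e / 2).
have := @admissible_ge0 (e / 4).
have -> : e / 2 - e / 4 = e / 4 by field.
move=> h1 h2; have : dphi (e / 4) * (e / 4) < y * (e / 4) by lra.
by rewrite ltr_pM2r // divr_gt0.
Qed.

(* Outside of [e, b] the tangents at e and b keep [phi t - y * t] above its
   values at e and b, so its minimum on [e / 2, b + 1] is a critical point. *)
Lemma dphi_ivt b y : 0 <= b -> 0 <= y -> y < dphi b -> derivative_range phi y.
Proof.
move=> b0; rewrite le_eqVlt => /predU1P[<- _|y0 yb].
  by exists 0 => //; rewrite half_lineE.
have [e e0 ey] := dphi_small y0.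
have eb : e < b.
  by rewrite ltNge; apply/negP => /(dphi_le b0); rewrite leNgt (lt_trans ey yb).
pose g (t : R) := phi t - y * t.
have dg (t : R) : 0 < t -> is_derive t 1 g (dphi t - y).
  move=> t0; have dt : is_derive t 1 phi (dphi t).
    rewrite /half_line_derivative gt_eqF // derive1E.
    by apply: DeriveDef => //; exact: phi_diff.2.
  by apply: is_derive_eq; rewrite /GRing.scale /= mulr1.
(* Starting at [e / 2] avoids 0, where the derivative is one-sided; the margins around [e, b] make
   the minimizer interior. *)
have [||c] := @EVT_min R g (e / 2) (b + 1); first by lra.
  apply: derivable_within_continuous => t; rewrite in_itv /= => /andP[et _].
  by have t0 : 0 < t by [lra]; case: (dg t t0).
rewrite in_itv /= => /andP[ec cb] gc.
have c0 : 0 < c by lra.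
have {}ec : e <= c.
  rewrite leNgt; apply/negP => ce.
  have := gc e; rewrite in_itv /= => /(_ ltac:(lra)); rewrite /g.
  have := tangent_le (ltW e0) (ltW c0).
  have : 0 < (y - dphi e) * (e - c) by apply: mulr_gt0; lra.
  by nra.
have {}cb : c <= b.
  rewrite leNgt; apply/negP => bc.
  have := gc b; rewrite in_itv /= => /(_ ltac:(lra)); rewrite /g.
  have := tangent_le b0 (ltW c0).
  have : 0 < (dphi b - y) * (c - b) by apply: mulr_gt0; lra.
  by nra.
exists c; first by rewrite half_lineE ltW.
have [] := @derive1_at_min R g (e / 2) (b + 1) c.
- by lra.
- by move=> t; rewrite in_itv /= => /andP[et _]; have t0 : 0 < t by [lra]; case: (dg t t0).
- by rewrite in_itv /=; lra.
- by move=> t; rewrite in_itv /= => /andP[? ?]; apply: gc; rewrite in_itv /=; lra.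
case: (dg c c0) => _ -> _; lra.
Qed.

Lemma derivative_inverseK a : 0 <= a -> derivative_inverse phi (dphi a) = a.
Proof.
move=> a0; rewrite /derivative_inverse pinvKV //; last by rewrite inE half_lineE.
move=> s t; rewrite !inE !half_lineE => s0 t0 st; apply/eqP; rewrite eq_le.
by apply/andP; split; rewrite leNgt; apply/negP => /dphi_lt;
  [move/(_ t0)|move/(_ s0)]; rewrite st ltxx.
Qed.

(** This trades the Lipschitz-like bound in [TSLM] for an inequality on [dphi], given membership in
    the range. *)
Lemma le_derivative_inverse a y : 0 <= a -> derivative_range phi y ->
  (a <= derivative_inverse phi y) = (dphi a <= y).
Proof.
move=> a0 [b]; rewrite half_lineE => b0 <-; rewrite derivative_inverseK //.
apply/idP/idP => [|ab]; first exact: dphi_le.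
by rewrite leNgt; apply/negP => /(dphi_lt b0); rewrite ltNge ab.
Qed.

(** The tangent at [t / 2] is evaluated at [t], and [phi (t / 2) >= 0] is dropped. *)
Lemma dphi_half_le t : 0 <= t -> dphi (t / 2) * t <= 2 * phi t.
Proof.
move=> t0.
have := @tangent_le (t / 2) t ltac:(lra) t0.
have := @admissible_ge0 (t / 2) ltac:(lra).
have -> : t - t / 2 = t / 2 by field.
by lra.
Qed.

Lemma le_dphi t : 0 <= t -> phi t <= dphi t * t.
Proof. by move=> t0; have := tangent_le t0 (lexx 0); rewrite admissible0; lra. Qed.

End ConvexDerivative.

(** * Minimal sublinear functionals and their linearity *)

Section Sublinear.
Context {R : realType} {X : lmodType R}.
Implicit Types (p q : X -> R) (x y z : X).

Definition sublinear p :=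
  (forall x y, p (x + y) <= p x + p y) /\
  (forall t x, 0 <= t -> p (t *: x) = t * p x).

Lemma sublinear0 p : sublinear p -> p 0 = 0.
Proof. by case=> _ /(_ 0 0 (lexx 0)); rewrite scale0r mul0r. Qed.

Lemma sublinearN_ge p x : sublinear p -> - p (- x) <= p x.
Proof.
by move=> sp; have := sp.1 x (- x); rewrite subrr sublinear0 // -lerBlDr sub0r.
Qed.

(** The reverse homogeneity inequality is the assumed one for [t^-1] at [t *: x]. *)
Lemma sublinear_criterion p : p 0 = 0 ->
    (forall x y, p (x + y) <= p x + p y) ->
    (forall t x, 0 < t -> p (t *: x) <= t * p x) ->
  sublinear p.
Proof.
move=> p0 pD pZ; split=> // t x; rewrite le_eqVlt => /predU1P[<-|t0].
  by rewrite scale0r mul0r.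
apply/eqP; rewrite eq_le pZ //= -ler_pdivlMl //.
have := pZ t^-1 (t *: x); rewrite scalerA mulVf ?gt_eqF // scale1r.
by apply; rewrite invr_gt0.
Qed.

(** The common bound [- p0 (- x)] keeps the infima finite. For subadditivity, of two members of the
    chain the smaller one serves at both points. *)
Lemma inf_chain_sublinear p0 (C : set (X -> R)) : C !=set0 ->
    (forall p, C p -> sublinear p) -> (forall p x, C p -> p x <= p0 x) ->
    total_on C (fun p q => forall x, p x <= q x) ->
  sublinear (fun x => inf [set p x | p in C]) /\
  (forall p x, C p -> inf [set q x | q in C] <= p x).
Proof.
move=> [p1 Cp1] sC Cp0 totC.
have lb x : has_lbound [set p x | p in C].
  exists (- p0 (- x)) => _ [p Cp <-]; apply: le_trans (sublinearN_ge _ (sC _ Cp)).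
  by rewrite lerN2 Cp0.
have infle p x : C p -> inf [set q x | q in C] <= p x.
  by move=> Cp; apply: ge_inf => //; exists p.
have leinf (y : R) x : (forall p, C p -> y <= p x) -> y <= inf [set q x | q in C].
  move=> h; apply: lb_le_inf; first by exists (p1 x), p1.
  by move=> _ [p Cp <-]; exact: h.
split=> //; apply: sublinear_criterion.
- apply/eqP; rewrite eq_le; apply/andP; split.
    by apply: le_trans (infle _ _ Cp1) _; rewrite sublinear0 //; exact: sC.
  by apply: (leinf) => p /sC /sublinear0 ->.
- move=> x y /=; rewrite -lerBlDr; apply: (leinf) => p Cp; rewrite lerBlDr [leRHS]addrC -lerBlDr.
  apply: (leinf) => q Cq; rewrite lerBlDr.
  have [pq|qp] := totC p q Cp Cq.
    apply: le_trans (infle p _ Cp) _; apply: le_trans ((sC _ Cp).1 _ _) _.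
    by rewrite addrC lerD2r.
  apply: le_trans (infle q _ Cq) _; apply: le_trans ((sC _ Cq).1 _ _) _.
  by rewrite addrC lerD2l.
- move=> t x t0 /=; rewrite -ler_pdivrMl //; apply: (leinf) => p Cp.
  by rewrite ler_pdivrMl // -((sC _ Cp).2 _ _ (ltW t0)); exact: infle.
Qed.

(** For sublinear [p], taking [t = 1] bounds the value at [- z] by [- p z], as linearity along [z]
    would demand. *)
Definition lower_along p z x := inf [set p (x + t *: z) - t * p z | t in half_line].

(** The set is bounded below by [- p (- x)], since [s *: z] is the sum of [x + s *: z] and [- x]. *)
Lemma lower_along_le p z t x : sublinear p -> 0 <= t ->
  lower_along p z x <= p (x + t *: z) - t * p z.
Proof.
move=> sp t0; apply: ge_inf; last by exists t => //; rewrite half_lineE.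
exists (- p (- x)) => _ [s + <-]; rewrite half_lineE => s0.
have := sp.1 (x + s *: z) (- x); rewrite addrAC subrr add0r sp.2 //; lra.
Qed.

Lemma le_lower_along p z (y : R) x : 
  (forall t, 0 <= t -> y <= p (x + t *: z) - t * p z) -> y <= lower_along p z x.
Proof.
move=> h; apply: lb_le_inf.
  by exists (p (x + 0 *: z) - 0 * p z), 0 => //; rewrite half_lineE.
by move=> _ [s + <-]; rewrite half_lineE; exact: h.
Qed.

(** Parameters [t] for [x] and [s] for [y] combine to [t + s] for [x + y]; a parameter [s] for [x]
    becomes [t * s] for [t *: x]. *)
Lemma lower_along_sublinear p z : sublinear p -> sublinear (lower_along p z).
Proof.
move=> sp; apply: sublinear_criterion.
- apply/eqP; rewrite eq_le; apply/andP; split.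
    apply: le_trans (lower_along_le _ _ sp (lexx 0)) _.
    by rewrite scale0r addr0 mul0r subr0 sublinear0.
  by apply: le_lower_along => t t0; rewrite add0r sp.2 // subrr.
- move=> x y /=; rewrite -lerBlDr; apply: le_lower_along => t t0.
  rewrite lerBlDr [leRHS]addrC -lerBlDr; apply: le_lower_along => s s0; rewrite lerBlDr.
  apply: le_trans (lower_along_le _ _ sp (addr_ge0 t0 s0)) _.
  have := sp.1 (x + t *: z) (y + s *: z).
  by rewrite addrACA -scalerDl; lra.
- move=> t x t0 /=; rewrite -ler_pdivrMl //; apply: le_lower_along => s s0.
  rewrite ler_pdivrMl //; apply: le_trans (lower_along_le _ _ sp (mulr_ge0 (ltW t0) s0)) _.
  by rewrite -scalerA -scalerDr (sp.2 _ _ (ltW t0)) -mulrA mulrBr.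
Qed.

Lemma lower_along_le_id p z x : sublinear p -> lower_along p z x <= p x.
Proof.
by move=> sp; apply: le_trans (lower_along_le _ _ sp (lexx 0)) _;
  rewrite scale0r addr0 mul0r subr0.
Qed.

Lemma minimal_sublinear p0 : sublinear p0 ->
  exists p, [/\ sublinear p, forall x, p x <= p0 x &
    forall q, sublinear q -> (forall x, q x <= p x) -> q = p].
Proof.
move=> sp0; pose below p := sublinear p /\ forall x, p x <= p0 x.
pose T := {p : X -> R | below p}.
(* The order is reversed, so that a maximal element is a minimal functional. *)
have [| | | |[p [sp pp0]] pmin] := @Zorn T (fun p q : T => `[< forall x, sval q x <= sval p x >]).
- by move=> p; apply/asboolP.
- move=> p q r /asboolP pq /asboolP qr; apply/asboolP => x.
  exact: le_trans (qr x) (pq x).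
- move=> [p ?] [q ?] /asboolP /= pq /asboolP /= qp; apply: eq_exist.
  by apply/funext => x; apply/eqP; rewrite eq_le pq qp.
- move=> A totA; have [[a Aa]|/set0P/negP/negPn/eqP A0] := pselect (A !=set0); last first.
    (* The empty chain is bounded by [p0] itself. *)
    by exists (exist below p0 (conj sp0 (fun x => lexx _))) => s; rewrite A0.
  pose C := [set sval s | s in A].
  have [||||sC leC] := @inf_chain_sublinear p0 C.
  + by exists (sval a), a.
  + by move=> _ [s _ <-]; case: (svalP s).
  + by move=> _ x [s _ <-]; case: (svalP s).
  + move=> _ _ [s As <-] [t At <-]; have [/asboolP|/asboolP] := totA s t As At; by [right|left].
  have le0 x : inf [set q x | q in C] <= p0 x.
    apply: (@le_trans _ _ (sval a x)); first by apply: leC; exists a.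
    by case: (svalP a).
  exists (exist below _ (conj sC le0)) => s As; apply/asboolP => x /=.
  by apply: leC; exists s.
exists p; split=> // q sq qp.
have qp0 x : q x <= p0 x by exact: le_trans (qp x) (pp0 x).
by have /(congr1 sval) := pmin (exist below q (conj sq qp0)) (introT (asboolP _) qp).
Qed.

(** Minimality gives [lower_along p z = p], and [t = 1] then yields [p x <= p (x + z) - p z], the
    converse of subadditivity. *)
Lemma minimal_sublinear_scalar p : sublinear p ->
  (forall q, sublinear q -> (forall x, q x <= p x) -> q = p) -> scalar p.
Proof.
move=> sp pmin.
have pD x z : p (x + z) = p x + p z.
  apply/eqP; rewrite eq_le sp.1 /= -lerBrDr.
  rewrite -{1}(pmin _ (lower_along_sublinear z sp) (fun y => lower_along_le_id z y sp)).
  by apply: le_trans (lower_along_le z x sp ler01) _; rewrite scale1r mul1r.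
have pN x : p (- x) = - p x.
  by apply/eqP; rewrite -addr_eq0 -pD addNr sublinear0.
move=> a x y; rewrite pD; congr (_ + _).
have [a0|/ltW a0] := leP 0 a; first exact: sp.2.
by rewrite -[a in LHS]opprK scaleNr pN sp.2 ?oppr_ge0 // mulNr opprK.
Qed.

End Sublinear.

(** * The dual norm and norming functionals *)

Section Dual.
Context {R : realType} {X : completeNormedModType R}.
Implicit Types (u v w : X -> R) (x y : X).

Lemma dual0 : topological_dual (0 : X -> R).
Proof.
by split; [move=> a x y; rewrite mulr0 addr0|exact: cst_continuous].
Qed.

Lemma dualD u v : topological_dual u -> topological_dual v -> topological_dual (u + v).
Proof.
move=> [lu cu] [lv cv]; split; last by move=> x; apply: cvgD; [exact: cu|exact: cv].
by move=> a x y; rewrite /= !fctE lu lv mulrDr addrACA.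
Qed.

Lemma dualZ a u : topological_dual u -> topological_dual (fun x => a * u x).
Proof.
move=> [lu cu]; split; last by move=> x; apply: cvgMl_tmp; exact: cu.
by move=> b x y; rewrite /= lu; ring.
Qed.

Lemma dualB u v : topological_dual u -> topological_dual v -> topological_dual (u - v).
Proof.
move=> [lu cu] [lv cv]; split; last by move=> x; apply: cvgB; [exact: cu|exact: cv].
by move=> a x y; rewrite /= !fctE lu lv; ring.
Qed.

Lemma dual_apply0 u : topological_dual u -> u 0 = 0.
Proof. by case=> /(_ 1 0 0); rewrite scaler0 addr0 mul1r; lra. Qed.

Lemma dual_applyZ u a x : topological_dual u -> u (a *: x) = a * u x.
Proof. by move=> du; have := du.1 a x 0; rewrite !addr0 (dual_apply0 du) addr0. Qed.

Lemma dual_applyB u x y : topological_dual u -> u (x - y) = u x - u y.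
Proof.
by move=> [lu _]; have := lu (-1) y x; rewrite scaleN1r mulN1r [- y + x]addrC [- u y + _]addrC.
Qed.

(** Continuity at 0 bounds [u] by 1 on a ball of radius [e], into which [e / 2] scales the unit
    ball. Hence the [sup] in [dual_norm] is a true supremum. *)
Lemma dual_has_ubound u : topological_dual u ->
  has_ubound [set `|u x| | x in [set x : X | `|x| <= 1]].
Proof.
move=> du; have /cvgrPdist_lt /(_ 1 ltr01) /nbhs_normP[e /= e0 he] := du.2 0.
exists (2 / e) => _ [x /= x1 <-].
have := he ((e / 2) *: x); rewrite /= sub0r normrN normrZ gtr0_norm ?divr_gt0 //.
rewrite dual_apply0 // sub0r normrN dual_applyZ // normrM gtr0_norm ?divr_gt0 //.
move=> H; have ex : e * `|x| <= e * 1 by rewrite ler_pM2l.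
rewrite ler_pdivlMr //; have := H ltac:(lra); lra.
Qed.

Lemma dual_norm_ge u x : topological_dual u -> `|x| <= 1 -> `|u x| <= dual_norm u.
Proof. by move=> du x1; apply: ub_le_sup; [exact: dual_has_ubound|exists x]. Qed.

Lemma dual_norm_le u (a : R) : (forall x, `|x| <= 1 -> `|u x| <= a) -> dual_norm u <= a.
Proof.
move=> h; apply: ge_sup; first by exists `|u 0|, 0 => //=; rewrite normr0.
by move=> _ [x x1 <-]; exact: h.
Qed.

Lemma dual_norm_apply u x : topological_dual u -> `|u x| <= dual_norm u * `|x|.
Proof.
move=> du; have [->|x0] := eqVneq x 0.
  by rewrite dual_apply0 // !normr0 mulr0.
have n0 : 0 < `|x| by rewrite normr_gt0.
rewrite -ler_pdivrMr // mulrC -[X in X * _]gtr0_norm ?invr_gt0 // -normrM -dual_applyZ //.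
apply: dual_norm_ge => //.
by rewrite normrZ gtr0_norm ?invr_gt0 // mulVf // gt_eqF.
Qed.

Lemma dual_norm_ge0 u : topological_dual u -> 0 <= dual_norm u.
Proof.
by move=> du; apply: le_trans (dual_norm_ge (x := 0) du _) => //; rewrite normr0.
Qed.

Lemma dual_norm0 : dual_norm (0 : X -> R) = 0.
Proof.
apply/eqP; rewrite eq_le dual_norm_ge0 ?andbT; last exact: dual0.
by apply: dual_norm_le => x _; rewrite normr0.
Qed.

Lemma dual_normD u v : topological_dual u -> topological_dual v ->
  dual_norm (u + v) <= dual_norm u + dual_norm v.
Proof.
move=> du dv; apply: dual_norm_le => x x1.
by apply: le_trans (ler_normD _ _) _; apply: lerD; exact: dual_norm_ge.
Qed.

Lemma dual_normB u v : topological_dual u -> topological_dual v ->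
  dual_norm (u - v) <= dual_norm u + dual_norm v.
Proof.
move=> du dv; apply: dual_norm_le => x x1.
by apply: le_trans (ler_normB _ _) _; apply: lerD; exact: dual_norm_ge.
Qed.

(* A functional below [lower_along normr y] is at most [- `|y|] at [- y]: take
   [t = 1] in the infimum. *)
Lemma hahn_banach_norming y :
  exists u, [/\ topological_dual u, forall x, u x <= `|x| & u y = `|y|].
Proof.
have sn : @sublinear R X (fun x => `|x|).
  by split=> [x z|t x t0]; [exact: ler_normD|rewrite normrZ ger0_norm].
have [u [su ule umin]] := minimal_sublinear (lower_along_sublinear y sn).
have lu := minimal_sublinear_scalar su umin.
have un x : u x <= `|x| by apply: le_trans (ule x) _; exact: lower_along_le_id sn.
have uN x : u (- x) = - u x.
  by have := lu (-1) x 0; rewrite !addr0 scaleN1r mulN1r sublinear0 // addr0.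
have uB x z : u (x - z) = u x - u z.
  by have := lu 1 x (- z); rewrite scale1r mul1r uN.
have ua x : `|u x| <= `|x|.
  by rewrite ler_norml un andbT lerNl -uN (le_trans (un _)) // normrN.
exists u; split=> //.
  split=> // x; apply/cvgrPdist_lt => e e0; near=> z.
  rewrite -uB; apply: le_lt_trans (ua _) _.
  by near: z; apply: cvgr_dist_lt.
apply/eqP; rewrite eq_le un /= -lerN2 -uN; apply: le_trans (ule _) _.
apply: le_trans (lower_along_le y (- y) sn ler01) _.
by rewrite scale1r addNr normr0 sub0r mul1r.
Unshelve. all: by end_near. Qed.

(** A norming functional is multiplied by [s]; its value at the nonzero [y] forces the norm to be at
    least [s]. *)
Lemma dual_norming y s : y != 0 -> 0 <= s ->
  exists w, [/\ topological_dual w, dual_norm w = s & w y = s * `|y|].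
Proof.
move=> y0 s0; have [u [du un uy]] := hahn_banach_norming y.
have n0 : 0 < `|y| by rewrite normr_gt0.
have dw := dualZ s du.
exists (fun x => s * u x); split=> //; last by rewrite uy.
apply/eqP; rewrite eq_le; apply/andP; split.
  apply: dual_norm_le => x x1; rewrite normrM (ger0_norm s0) ler_piMr //.
  apply: le_trans x1; rewrite ler_norml un andbT lerNl -mulN1r -dual_applyZ //.
  by rewrite scaleN1r -[leRHS]normrN.
have := dual_norm_apply y dw; rewrite /= uy normrM normr_id (ger0_norm s0).
by rewrite ler_pM2r.
Qed.

Lemma dual_ball0 (d : R) : 0 < d -> dual_ball d (0 : X -> R).
Proof. by move=> d0; split; [exact: dual0|rewrite dual_norm0]. Qed.

End Dual.

(** * The two implications between well-posedness and tilt stability *)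

Section Equivalence.
Context {R : realType} (phi : R -> R).
Hypothesis phi_adm : admissible phi.
Hypothesis phi_diff : half_line_differentiable phi.
Hypothesis phi_conv : strictly_convex_on half_line phi.
Hypothesis phi_d0 : half_line_derivative phi 0 = 0.
Context {X : completeNormedModType R} (f : X -> \bar R) (xbar : X).
Hypothesis f_gtNy : forall x, (-oo < f x)%E.
Hypothesis xbar_dom : eff_dom f xbar.

Local Notation dphi := (half_line_derivative phi).

Lemma eff_domP x : eff_dom f x -> exists a : R, f x = a%:E.
Proof. by rewrite /eff_dom /=; have := f_gtNy x; case: (f x) => // a _ _; exists a. Qed.

Lemma closed_ball_norm (r : R) (x : X) : 0 < r ->
  closed_ball xbar r x <-> `|xbar - x| <= r.
Proof. by move=> r0; rewrite closed_ballE. Qed.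

Lemma SLWP_TSLM : SLWP phi f xbar ->
  TSLM (derivative_range phi) (derivative_inverse phi) f xbar.
Proof.
move=> [d [r [tau [kap [[d0 r0 tau0 kap0] [c [c0 H]]]]]]].
have growth u x b : dual_ball d u -> closed_ball xbar r x -> f x = b%:E ->
    exists2 a, f (c u) = a%:E &
      phi (kap * `|x - c u|) <= tau * ((b - u x) - (a - u (c u))).
  move=> du xr fx; have [cr /(_ _ xr)] := H u du.
  have := f_gtNy (c u); rewrite /tilt fx; case: (f (c u)) => [a| |] //= _.
    by rewrite lee_fin => ?; exists a.
  (* If [f (c u)] were [+oo], the right-hand side would be [-oo], below a real value of [phi]. *)
  by rewrite gt0_muleNy ?lte_fin.
have dom u : dual_ball d u -> exists a, f (c u) = a%:E.
  have [b fb] := eff_domP xbar_dom.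
  move=> du; have [||a] // := growth u xbar b du; last by exists a.
  exact: closed_ballxx.
have ke0 : 0 < kap / 2 by rewrite divr_gt0.
(* The values of [f] cancel in the sum of the two growth inequalities; [dphi_half_le] is then used
   at [kap * |c u1 - c u2|], which accounts for [kap / 2]. *)
have mono u1 u2 : dual_ball d u1 -> dual_ball d u2 ->
    dphi (kap / 2 * `|c u1 - c u2|) <= tau / kap * dual_norm (u1 - u2).
  move=> du1 du2; have du := dualB du1.1 du2.1.
  have [a1 fa1] := dom u1 du1; have [a2 fa2] := dom u2 du2.
  have [a] := growth u1 (c u2) a2 du1 (H u2 du2).1 fa2.
  rewrite fa1 => -[<-] {a} h1.
  have [a] := growth u2 (c u1) a1 du2 (H u1 du1).1 fa1.
  rewrite fa2 => -[<-] {a} h2.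
  rewrite distrC in h1.
  have : (u1 - u2) (c u1 - c u2) <= dual_norm (u1 - u2) * `|c u1 - c u2|.
    by apply: le_trans (ler_norm _) _; exact: dual_norm_apply.
  rewrite !fctE (dual_applyB _ _ du1.1) (dual_applyB _ _ du2.1) -(ler_pM2l tau0) => h3.
  have := dphi_half_le phi_adm phi_diff phi_conv phi_d0 (mulr_ge0 (ltW kap0) (normr_ge0 (c u1 - c u2))).
  have -> : kap * `|c u1 - c u2| / 2 = kap / 2 * `|c u1 - c u2| by rewrite mulrAC.
  have [n0|n0] := eqVneq `|c u1 - c u2| 0.
    by rewrite n0 mulr0 phi_d0 => _; rewrite mulr_ge0 ?dual_norm_ge0 // divr_ge0 // ltW.
  have {}n0 : 0 < `|c u1 - c u2| by rewrite lt_neqAle eq_sym n0 normr_ge0.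
  move=> h4; rewrite [leRHS]mulrAC ler_pdivlMr // -(ler_pM2r n0); lra.
have m0 : 0 < dphi (kap / 2 * r) by apply: dphi_gt0 => //; rewrite mulr_gt0.
have tk0 : 0 < tau / kap by rewrite divr_gt0.
have tk20 : 0 < 2 * (tau / kap) by rewrite mulr_gt0 // ltr0n.
(* Two functionals in the new ball differ by less than [2 * d'], so [tau / kap] times the norm of
   their difference stays below [dphi (kap / 2 * r)]. This gives membership in the range of [dphi]
   and confines [c u]. *)
pose d' := Num.min d (dphi (kap / 2 * r) / (2 * (tau / kap))).
have d'0 : 0 < d' by rewrite lt_min d0 divr_gt0.
have d'd (u : X -> R) : dual_ball d' u -> dual_ball d u.
  by move=> [du un]; split=> //; apply: lt_le_trans un _; rewrite ge_min lexx.
have d'm (u1 u2 : X -> R) : dual_ball d' u1 -> dual_ball d' u2 ->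
    tau / kap * dual_norm (u1 - u2) < dphi (kap / 2 * r).
  move=> [du1 n1] [du2 n2]; have nD := dual_normB du1 du2.
  have : d' <= dphi (kap / 2 * r) / (2 * (tau / kap)) by rewrite ge_min lexx orbT.
  rewrite ler_pdivlMr // => h.
  have : tau / kap * dual_norm (u1 - u2) < tau / kap * (2 * d') by rewrite ltr_pM2l //; lra.
  by lra.
have ball0 := dual_ball0 (X := X) d'0.
(* [SLWP] only places [c u] in the closed ball, while [TSLM] minimizes over the open one; [mono]
   against [c 0 = xbar] excludes the boundary. *)
have cr u : dual_ball d' u -> `|c u - xbar| < r.
  move=> du; rewrite ltNge; apply/negP => rc.
  have := mono u 0 (d'd _ du) (d'd _ ball0); rewrite c0.
  move=> /le_lt_trans /(_ (d'm _ _ du ball0)); rewrite ltNge => /negP; apply.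
  apply: dphi_le => //; first by rewrite mulr_ge0 // ltW.
  by rewrite ler_pM2l.
exists d', r, (kap / 2), (tau / kap); split=> //; exists c; split=> //.
- by move=> u /d'd /H[].
- move=> u du; split; first by rewrite -ball_normE /= distrC cr.
  move=> y yr; rewrite /tilt; have := f_gtNy y.
  case fy : (f y) => [b| |] // _; last by rewrite addye // leey.
  have [|a fa h] := growth u y b (d'd _ du) _ fy; first exact: subset_closure.
  rewrite fa /= lee_fin.
  have := admissible_ge0 phi_adm (mulr_ge0 (ltW kap0) (normr_ge0 (y - c u))).
  by move=> /le_trans /(_ h); rewrite pmulr_rge0 //; lra.
- move=> u1 u2 du1 du2.
  have D0 := dual_norm_ge0 (dualB du1.1 du2.1).
  have rg : derivative_range phi (tau / kap * dual_norm (u1 - u2)).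
    apply: (dphi_ivt phi_adm phi_diff phi_conv phi_d0 _ _ (d'm _ _ du1 du2)).
      by rewrite mulr_ge0 // ltW.
    by rewrite mulr_ge0 // ltW.
  split=> //; rewrite le_derivative_inverse //; last by rewrite mulr_ge0 // ltW.
  by apply: mono; exact: d'd.
Qed.

Lemma TSLM_SLWP :
  TSLM (derivative_range phi) (derivative_inverse phi) f xbar -> SLWP phi f xbar.
Proof.
move=> [d [r [kap [tau [[d0 r0 kap0 tau0] [M [Mr M0 Mmin Mlip]]]]]]].
have [b0 fb0] := eff_domP xbar_dom.
have min_le u x b : dual_ball d u -> ball xbar r x -> f x = b%:E ->
    exists2 a, f (M u) = a%:E & a - u (M u) <= b - u x.
  move=> du xr fx; have [_ /(_ x xr)] := Mmin u du; rewrite /tilt fx.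
  have := f_gtNy (M u); case: (f (M u)) => [a| |] // _.
  by rewrite /= lee_fin => ?; exists a.
have [e e0 he] := dphi_small phi_adm phi_diff phi_conv phi_d0
  (divr_gt0 (mulr_gt0 tau0 d0) (ltr0Sn _ 1)).
(* The first bound puts the closed ball of radius [r'] inside the open ball of radius [r]; the
   second gives [dphi (kap * r') < tau * d / 2]. *)
pose r' := Num.min (r / 2) (e / kap).
have r'0 : 0 < r' by rewrite lt_min !divr_gt0.
have r'r : r' < r.
  have : r' <= r / 2 by rewrite ge_min lexx.
  lra.
have dr' : dphi (kap * r') < tau * d / 2.
  apply: le_lt_trans he; apply: dphi_le => //; first by rewrite mulr_ge0 // ltW.
  by rewrite mulrC -ler_pdivlMr // ge_min lexx orbT.
have m0 : 0 < dphi (kap * r') by apply: dphi_gt0 => //; rewrite mulr_gt0.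
(* Tilts smaller than [d'] move the minimizer by less than [r'], and [d' < d / 2] leaves room for
   the further tilt [w]. *)
pose d' := dphi (kap * r') / tau.
have d'0 : 0 < d' by rewrite divr_gt0.
have d'd : d' < d / 2 by rewrite ltr_pdivrMr //; lra.
have in_d (u : X -> R) : dual_ball d' u -> dual_ball d u.
  by move=> [du un]; split=> //; lra.
have mono u1 u2 : dual_ball d u1 -> dual_ball d u2 ->
    dphi (kap * `|M u1 - M u2|) <= tau * dual_norm (u1 - u2).
  move=> du1 du2; have [D] := Mlip u1 u2 du1 du2.
  by rewrite le_derivative_inverse // mulr_ge0 // ltW.
have Mr' u : dual_ball d' u -> `|M u - xbar| < r'.
  move=> du; rewrite ltNge; apply/negP => rM.
  have := mono u 0 (in_d _ du) (dual_ball0 d0); rewrite M0 subr0.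
  have : tau * dual_norm u < dphi (kap * r').
    by rewrite mulrC -ltr_pdivlMr //; exact: du.2.
  move=> /[swap] /le_lt_trans /[apply]; rewrite ltNge => /negP; apply.
  by apply: dphi_le => //; [rewrite mulr_ge0 // ltW|rewrite ler_pM2l].
(* With [t = kap / 2 * |y|], multiplying the final bound [dphi t / tau * (|y| / 2)] by [kap * tau]
   gives exactly [dphi t * t]. *)
exists d', r', (kap * tau), (kap / 2); split.
  by split=> //; [rewrite mulr_gt0|rewrite divr_gt0].
exists M; split=> // u du; have dud := in_d _ du; split.
  by apply/closed_ball_norm => //; rewrite distrC ltW // Mr'.
move=> x /closed_ball_norm - /(_ r'0) xr'.
have [au fau _] := min_le u xbar b0 dud (ballxx _ r0) fb0.
have := f_gtNy x; rewrite /tilt fau; case fx : (f x) => [b| |] // _; last first.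
  by rewrite gt0_muley ?leey // lte_fin mulr_gt0.
rewrite /= lee_fin.
have [xM|xM] := eqVneq x (M u).
  move: fx; rewrite xM fau => -[->].
  by rewrite !subrr normr0 !mulr0 (admissible0 phi_adm).
pose y := x - M u.
have y0 : y != 0 by rewrite subr_eq0.
have n0 : 0 < `|y| by rewrite normr_gt0.
have yr : `|y| <= 2 * r'.
  have -> : y = (x - xbar) + (xbar - M u) by rewrite /y addrA subrK.
  apply: le_trans (ler_normD _ _) _; rewrite distrC [X in _ + X]distrC.
  by have := Mr' u du; lra.
pose t := kap / 2 * `|y|.
have t0 : 0 <= t by rewrite mulr_ge0 // divr_ge0 // ltW.
have dt0 : 0 < dphi t by apply: dphi_gt0 => //; rewrite mulr_gt0 // divr_gt0.
(* At norm [dphi t / tau] the modulus in [TSLM] is the inverse derivative at [dphi t], namely [t];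
   this is half of [kap * |y|]. *)
have [w [dw wn wy]] := dual_norming y0 (divr_ge0 (ltW dt0) (ltW tau0)).
have tr' : t <= kap * r'.
  by have : kap * `|y| <= kap * (2 * r') by [rewrite ler_pM2l]; rewrite /t; lra.
have wd : dual_norm w < d / 2.
  rewrite wn; apply: le_lt_trans d'd; rewrite ler_pM2r ?invr_gt0 //.
  exact: dphi_le.
have dv : dual_ball d (u + w).
  split; first exact: dualD du.1 dw.
  have := dual_normD du.1 dw; have := du.2; lra.
have xr : ball xbar r x by rewrite -ball_normE /=; exact: le_lt_trans r'r.
have [av fav h1] := min_le (u + w) x b dv xr fx.
have [a] := min_le u (M (u + w)) av dud (Mmin _ dv).1 fav.
rewrite fau => -[<-] {a} h2.
have near_M : `|M (u + w) - M u| <= `|y| / 2.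
  have [_] := Mlip (u + w) u dv dud.
  have -> : u + w - u = w by rewrite addrAC subrr add0r.
  rewrite wn [tau * _]mulrC divfK ?gt_eqF // derivative_inverseK //.
  by move=> Mt; rewrite -(ler_pM2l kap0); apply: le_trans Mt _; rewrite /t; lra.
have : w (M (u + w) - M u) <= dphi t / tau * (`|y| / 2).
  apply: le_trans (ler_norm _) _; apply: le_trans (dual_norm_apply _ dw) _.
  by rewrite wn ler_pM2l // divr_gt0.
rewrite (dual_applyB _ _ dw) => h3.
rewrite (dual_applyB _ _ dw) in wy.
(* Adding [h1] and [h2] eliminates [av] and leaves [w y - w (M (u + w) - M u)] as a lower bound;
   [wy] and [h3] estimate its two terms. *)
have gr : dphi t / tau * (`|y| / 2) <= b - u x - (au - u (M u)).
  by rewrite !fctE in h1; lra.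
apply: le_trans (le_dphi phi_adm phi_diff phi_conv phi_d0 t0) _.
rewrite -(ler_pM2l (mulr_gt0 kap0 tau0)) in gr; apply: le_trans gr.
rewrite le_eqVlt; apply/orP; left; apply/eqP; rewrite /t; field.
by rewrite gt_eqF.
Qed.

End Equivalence.

Theorem theorem4p5 (R : realType) (phi : R -> R)
    (phi_adm : admissible phi)
    (phi_diff : half_line_differentiable phi)
    (phi_conv : strictly_convex_on half_line phi)
    (phi_d0 : half_line_derivative phi 0 = 0)
    (X : completeNormedModType R) (f : X -> \bar R)
    (f_proper : proper_fun f)
    (f_lsc : lower_semicontinuous f)
    (xbar : X) (xbar_dom : eff_dom f xbar) :
  SLWP phi f xbar <->
  TSLM (derivative_range phi) (derivative_inverse phi) f xbar.
Proof.
have f_gtNy := f_proper.1.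
split; first exact: SLWP_TSLM.
exact: TSLM_SLWP.
Qed.
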